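(* Let $\mathbb{K}$ be an algebraically closed field of characteristic $0$, let $n\geq 1$, and let $L$ be any Lie algebra over $\mathbb{K}$ of dimension $n$. Then there exists a basic subalgebra $\overline{L}$ of $W_n(\mathbb{K})$ such that $\overline{L}$ is isomorphic to $L$ as a Lie algebra over $\mathbb{K}$.
   Context: Let $R=\mathbb{K}[x_1,\ldots,x_n]$ be the polynomial ring in $n$ variables. $W_n(\mathbb{K})$ denotes the Lie algebra over $\mathbb{K}$ (under the commutator bracket) of all $\mathbb{K}$-derivations of $R$; it is also a free $R$-module of rank $n$ with basis $\frac{\partial}{\partial x_1},\ldots,\frac{\partial}{\partial x_n}$. A Lie subalgebra $L'$ of $W_n(\mathbb{K})$ of dimension $n$ over $\mathbb{K}$ is called basic if every basis of $L'$ over $\mathbb{K}$ is a basis of the $R$-module $W_n(\mathbb{K})$. *)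

(* Defs.v *)
From HB Require Import structures.
From mathcomp Require Import all_boot all_algebra.
From mathcomp Require Import boolp classical_sets functions.
From mathcomp Require Import mpoly.
From mathcomp Require Import ring.

Set Implicit Arguments.
Unset Strict Implicit.
Unset Printing Implicit Defensive.

Import GRing.Theory.
Local Open Scope ring_scope.
Local Open Scope classical_set_scope.

HB.mixin Record Lmodule_isLieAlgebra (K : fieldType) L of GRing.Lmodule K L := {
  lie : L -> L -> L;
  lie_linearl : forall (a : K) (x y z : L),
    lie (a *: x + y) z = a *: lie x z + lie y z;
  lie_linearr : forall (a : K) (x y z : L),
    lie x (a *: y + z) = a *: lie x y + lie x z;
  liexx : forall x : L, lie x x = 0;
  lie_jacobi : forall x y z : L,
    lie x (lie y z) + lie y (lie z x) + lie z (lie x y) = 0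
}.

#[short(type="lieAlgType")]
HB.structure Definition LieAlgebra (K : fieldType) :=
  { L of Lmodule_isLieAlgebra K L & GRing.Lmodule K L }.

(* Finite-dimensional Lie algebras; the dimension of L is \dim {:L}. *)
#[short(type="finDimLieAlgType")]
HB.structure Definition FinDimLieAlgebra (K : fieldType) :=
  { L of LieAlgebra K L & Vector K L }.

(* Unlike basis_of, this applies to modules over any ring and to subsets of
   infinite-dimensional spaces. *)
Definition is_basis (A : nzRingType) (V : lmodType A) (S : set V) (n : nat)
    (b : 'I_n -> V) : Prop :=
  S = [set v | exists c : 'I_n -> A, v = \sum_(i < n) c i *: b i] /\
  (forall c : 'I_n -> A, \sum_(i < n) c i *: b i = 0 -> forall i, c i = 0).

Definition lie_subalgebra (K : fieldType) (L : lieAlgType K) (S : set L) : Prop :=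
  [/\ S 0,
      forall (a : K) (x y : L), S x -> S y -> S (a *: x + y)
    & forall x y : L, S x -> S y -> S (lie x y)].

Definition lie_isom_onto (K : fieldType) (L M : lieAlgType K) (S : set M)
    (phi : L -> M) : Prop :=
  [/\ linear phi,
      forall x y : L, phi (lie x y) = lie (phi x) (phi y)
    & set_bij [set: L] S phi].

Section Derivations.
Variables (K : fieldType) (n : nat).
Local Notation R := {mpoly K[n]}.

Definition is_derivation (D : R -> R) : Prop :=
  linear D /\ forall f g : R, D (f * g) = D f * g + f * D g.

Definition der_pred : {pred R -> R} := [pred D | `[< is_derivation D >]].

Lemma der_predP (D : R -> R) : reflect (is_derivation D) (D \in der_pred).
Proof. exact: asboolP. Qed.

Lemma der_submod_closed : submod_closed der_pred.
Proof.
split=> [|a D E /der_predP[linD derD] /der_predP[linE derE]]; apply/der_predP.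
  split=> [a f g|f g]; first by rewrite scaler0 addr0.
  by rewrite mul0r mulr0 addr0.
have aE f : (a *: D + E) f = a%:MP * D f + E f by rewrite mul_mpolyC.
split=> [b f g|f g]; rewrite !aE.
  by rewrite linD linE -!mul_mpolyC; ring.
by rewrite derD derE; ring.
Qed.

HB.instance Definition _ :=
  GRing.isSubmodClosed.Build K (R -> R) der_pred der_submod_closed.

(* W_n(K), with its K-vector space structure inherited from R -> R. *)
Record derivation := Derivation { der_fun :> R -> R; _ : der_fun \in der_pred }.

HB.instance Definition _ := [isSub for der_fun].
HB.instance Definition _ := [Choice of derivation by <:].
HB.instance Definition _ := [SubChoice_isSubLmodule of derivation by <:].

Lemma derivationP (D : derivation) : is_derivation D.
Proof. by apply/der_predP; case: D. Qed.

Lemma derivation_eqP (D E : derivation) : D =1 E -> D = E.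
Proof. by move=> eqDE; apply/val_inj/funext. Qed.

HB.instance Definition _ (D : derivation) :=
  GRing.isLinear.Build K R R *:%R (der_fun D) (proj1 (derivationP D)).

Lemma derM (D : derivation) (f g : R) : D (f * g) = D f * g + f * D g.
Proof. by have [_] := derivationP D. Qed.

Lemma derivationDE (D E : derivation) (f : R) : (D + E) f = D f + E f.
Proof. by []. Qed.

Lemma derivationZE (a : K) (D : derivation) (f : R) : (a *: D) f = a *: D f.
Proof. by []. Qed.

Lemma der_lie_subproof (D E : derivation) :
  (fun f => D (E f) - E (D f)) \in der_pred.
Proof.
apply/der_predP; split=> [a f g|f g].
  by rewrite !linearD !linearZ /= -!mul_mpolyC; ring.
by rewrite !derM !linearD /= !derM; ring.
Qed.

Definition der_lie (D E : derivation) : derivation :=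
  Derivation (der_lie_subproof D E).

Lemma der_lieE (D E : derivation) (f : R) : der_lie D E f = D (E f) - E (D f).
Proof. by []. Qed.

Lemma der_lie_linearl (a : K) (D E F : derivation) :
  der_lie (a *: D + E) F = a *: der_lie D F + der_lie E F.
Proof.
apply: derivation_eqP => f.
rewrite !(der_lieE, derivationDE, derivationZE) linearD linearZ /=.
by rewrite -!mul_mpolyC; ring.
Qed.

Lemma der_lie_linearr (a : K) (D E F : derivation) :
  der_lie D (a *: E + F) = a *: der_lie D E + der_lie D F.
Proof.
apply: derivation_eqP => f.
rewrite !(der_lieE, derivationDE, derivationZE) linearD linearZ /=.
by rewrite -!mul_mpolyC; ring.
Qed.

Lemma der_liexx (D : derivation) : der_lie D D = 0.
Proof. by apply: derivation_eqP => f /=; rewrite subrr. Qed.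

Lemma der_jacobi (D E F : derivation) :
  der_lie D (der_lie E F) + der_lie E (der_lie F D) + der_lie F (der_lie D E) = 0.
Proof.
apply: derivation_eqP => f; rewrite !derivationDE !der_lieE !linearB /=.
by change (0 f) with (0 : R); ring.
Qed.

HB.instance Definition _ := Lmodule_isLieAlgebra.Build K derivation
  der_lie_linearl der_lie_linearr der_liexx der_jacobi.

Lemma der_scale_subproof (f : R) (D : derivation) : (fun g => f * D g) \in der_pred.
Proof.
apply/der_predP; split=> [a g h|g h]; last by rewrite derM; ring.
by rewrite linearD linearZ /= -!mul_mpolyC; ring.
Qed.

Definition der_scale (f : R) (D : derivation) : derivation :=
  Derivation (der_scale_subproof f D).

(* derivation itself carries the structure of a K-module; this alias carries
   that of a module over the polynomial ring. *)
Definition derivation_mod : Type := derivation.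

HB.instance Definition _ := GRing.Zmodule.copy derivation_mod derivation.

Lemma der_scaleA (f g : R) (D : derivation_mod) :
  der_scale f (der_scale g D) = der_scale (f * g) D.
Proof. by apply: derivation_eqP => h /=; rewrite mulrA. Qed.

Lemma der_scale1 : left_id 1 (der_scale : R -> derivation_mod -> derivation_mod).
Proof. by move=> D; apply: derivation_eqP => h /=; rewrite mul1r. Qed.

Lemma der_scaleDr :
  right_distributive (der_scale : R -> derivation_mod -> derivation_mod) +%R.
Proof. by move=> f D E; apply: derivation_eqP => h /=; rewrite mulrDr. Qed.

Lemma der_scaleDl (D : derivation_mod) :
  {morph (fun f : R => der_scale f D : derivation_mod) : f g / f + g}.
Proof. by move=> f g; apply: derivation_eqP => h /=; rewrite mulrDl. Qed.

HB.instance Definition _ := GRing.Zmodule_isLmodule.Build R derivation_mod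
  der_scaleA der_scale1 der_scaleDr der_scaleDl.

Definition basic (S : set derivation) : Prop :=
  [/\ lie_subalgebra S,
      exists b : 'I_n -> derivation, is_basis S b
    & forall b : 'I_n -> derivation, is_basis S b ->
        is_basis [set: derivation_mod] (b : 'I_n -> derivation_mod)].

End Derivations.

(* Main.v *)
(** It suffices to find an [L]-valued polynomial 1-form [omega = \sum_i om_i dx_i]
    in [n = dim L] variables which satisfies the Maurer-Cartan equation and whose
    values [om_i] form a basis of [R (x) L]: the dual vector fields are then
    the required copy of [L].

    Such a form on a subalgebra [P] extends to [Q = P (+) U] whenever [U] is
    a subalgebra acting nilpotently on [Q]: one multiplies by the factors
    [exp (x u)] for [u] in a basis of [U] adapted to a chain of subalgebras
    given by Engel's theorem.  To build [L] in this way, argue by induction on the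
    dimension.  If all elements are ad-nilpotent, take [P = 0].  Otherwise choose
    [h] not ad-nilpotent and split its nonzero eigenvalues as [C] and [- C] with
    [C] closed under addition and [0] not in [C]; then [Q = Q_0 + Q_(- C) + Q_C],
    where [Q_0] is a proper subalgebra and the other two are subalgebras acting
    nilpotently, because there are finitely many weights and adding elements of
    [C] to a weight never returns to it. *)

Require Import Defs.
From HB Require Import structures.
From mathcomp Require Import all_boot all_algebra.
From mathcomp Require Import boolp classical_sets functions.
From mathcomp Require Import mpoly.

Set Implicit Arguments.
Unset Strict Implicit.
Unset Printing Implicit Defensive.

Import GRing.Theory.
Local Open Scope ring_scope.
Local Open Scope classical_set_scope.

(** * Additive cones *)

(** A subspace of maximal dimension inside [P] exhausts [P], since adjoining a missing element would
    enlarge it. This turns weight spaces, given by predicates, into elements of [{vspace L}]. *)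
Lemma vspace_of_pred (K : fieldType) (V : vectType K) (P : V -> Prop) :
    P 0 -> (forall a x y, P x -> P y -> P (a *: x + y)) ->
  exists W : {vspace V}, forall v, v \in W <-> P v.
Proof.
move=> P0 PD.
pose B d := `[< exists2 W : {vspace V}, (forall v, v \in W -> P v) & \dim W = d >].
have exB : exists d, B d.
  by exists 0%N; apply/asboolP; exists 0%VS; rewrite ?dimv0 // => v /[!memv0] /eqP->.
have ubB d : B d -> (d <= \dim {:V})%N.
  by move=> /asboolP[W _ <-]; apply/dimvS/subvf.
have [d /asboolP[W WP dimW] maxd] := ex_maxnP exB ubB.
exists W => v; split=> [/WP//|Pv]; apply: contrapT => /negP vW.
have : B (\dim (W + <[v]>)).
  apply/asboolP; exists (W + <[v]>)%VS => // _ /memv_addP[w Ww [_ /vlineP[a ->] ->]].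
  by rewrite addrC; apply: PD => //; apply: WP.
move=> /maxd; rewrite -{}dimW (geq_leqif (dimv_leqif_sup (addvSl _ _))) => /subvP sub.
by move: vW; rewrite sub //; apply/(subvP (addvSr _ _))/memv_line.
Qed.

Section Cone.
Variables (K : fieldType).
Hypothesis charK : [pchar K] =i pred0.

(** Induct on [s], enlarging the cone by the new [x] or by [- x]. The cone stands in for an ordering
    of [K]. *)
Lemma total_cone (s : seq K) : exists C : K -> Prop,
  [/\ forall x y, C x -> C y -> C (x + y), ~ C 0 &
      forall x, x \in s -> [\/ x = 0, C x | C (- x)]].
Proof.
elim: s => [|x s [C [CD C0 Cs]]]; first by exists (fun=> False); split.
have [->|x0] := eqVneq x 0.
  exists C; split=> // y; rewrite inE => /predU1P[->|/Cs//]; exact: Or31.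
have CMn y k : C y -> C (y *+ k.+1).
  by move=> Cy; elim: k => // k IH; rewrite mulrS; apply: CD.
have Kn k y : y != 0 -> y *+ k.+1 != 0 :> K.
  by move=> y0; rewrite -mulr_natl mulf_neq0 // (proj1 (pcharf0P K) charK).
suff add y : y != 0 -> (forall k, ~ C (- (y *+ k.+1))) ->
  exists C' : K -> Prop, [/\ forall x z, C' x -> C' z -> C' (x + z), ~ C' 0,
    forall z, C z -> C' z & C' y].
  have ext y (e : y = x \/ y = - x) : (forall k, ~ C (- (y *+ k.+1))) -> exists C' : K -> Prop,
      [/\ forall x y, C' x -> C' y -> C' (x + y), ~ C' 0 &
      forall z, z \in x :: s -> [\/ z = 0, C' z | C' (- z)]].
    move=> /add[|C' [C'D C'0 CC' C'y]].
      by case: e => ->; rewrite ?oppr_eq0.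
    exists C'; split=> // z; rewrite inE => /predU1P[->|].
      case: e C'y => -> C'y; [exact: Or32|exact: Or33].
    by move=> /Cs[]; [constructor 1|constructor 2; apply: CC'|constructor 3; apply: CC'].
  have [|/existsNP[k /contrapT Ck]] := pselect (forall k, ~ C (- (x *+ k.+1))).
    by apply: ext; left.
  have [|/existsNP[l /contrapT Cl]] := pselect (forall k, ~ C (- ((- x) *+ k.+1))).
    by apply: ext; right.
  (* If both signs are obstructed, [C] contains a negative and a positive multiple of [x], hence
     multiples that cancel. *)
  case: C0; move: Cl; rewrite mulNrn opprK => Cl.
  have := CD _ _ (CMn _ l Ck) (CMn _ k Cl).
  by rewrite mulNrn -!mulrnA mulnC addNr.
move=> y0 Cy.
(* The cone generated by [C] and [y]; the last clause excludes the empty combination. *)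
exists (fun z => exists c k, [/\ c = 0 \/ C c, z = c + y *+ k & C c \/ (0 < k)%N]); split.
- move=> _ _ [c [k [Hc -> ck]]] [d [l [Hd -> dl]]]; exists (c + d), (k + l)%N; split.
  + case: Hc => [->|Hc]; rewrite ?add0r //; right.
    by case: Hd => [->|Hd]; rewrite ?addr0 //; apply: CD.
  + by rewrite mulrnDr addrACA.
  + case: ck => [ck|ck]; last by right; rewrite addn_gt0 ck.
    by case: Hd => [->|Hd]; left; rewrite ?addr0 //; apply: CD.
- move=> [c [k [Hc ck kk]]]; case: k ck kk => [|k].
    by rewrite addr0 => <- [].
  move=> /eqP /[1!eq_sym]; rewrite addr_eq0 => /eqP e _; case: Hc => Hc.
    by move: (Kn k y y0); rewrite -oppr_eq0 -e Hc eqxx.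
  by apply: (Cy k); rewrite -e.
- by move=> z Cz; exists z, 0%N; split; [right|rewrite addr0|left].
- by exists 0, 1%N; split; [left|rewrite add0r|right].
Qed.
End Cone.

(** * Generalized eigenspaces *)

Section GeneralizedEigen.
Variables (K : fieldType) (L : lmodType K) (A : {linear L -> L}).
Implicit Types (rs : seq K) (X Y : set K) (v w : L).

Definition kill rs v := foldl (fun w r => A w - r *: w) v rs.

Lemma killD rs v w : kill rs (v + w) = kill rs v + kill rs w.
Proof.
elim: rs v w => //= r rs IH v w; rewrite -IH; congr kill.
by rewrite linearD scalerDr opprD addrACA.
Qed.

Lemma killZ rs a v : kill rs (a *: v) = a *: kill rs v.
Proof.
elim: rs v => //= r rs IH v; rewrite -IH; congr kill.
by rewrite linearZ scalerBr !scalerA mulrC.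
Qed.

Lemma kill0 rs : kill rs 0 = 0.
Proof. by rewrite -(scale0r 0) killZ !scale0r. Qed.

Lemma killB rs v w : kill rs (v - w) = kill rs v - kill rs w.
Proof. by rewrite killD -scaleN1r killZ scaleN1r. Qed.

Lemma kill_im rs v : A (kill rs v) = kill rs (A v).
Proof.
by elim: rs v => //= r rs IH v; rewrite IH linearB linearZ.
Qed.

Lemma kill_cat rs1 rs2 v : kill (rs1 ++ rs2) v = kill rs2 (kill rs1 v).
Proof. exact: foldl_cat. Qed.

Lemma kill_catC rs1 rs2 v : kill rs1 (kill rs2 v) = kill rs2 (kill rs1 v).
Proof. by elim: rs1 v => //= r rs1 IH v; rewrite -IH kill_im -killZ -killB. Qed.

(* Elements killed by a product of factors [A - r] with all [r] in [X], that is
   the sum of the generalized eigenspaces of [A] for the eigenvalues in [X]. *)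
Definition geig X v := exists2 rs, (forall r, r \in rs -> X r) & kill rs v = 0.

Lemma geig0 X : geig X 0.
Proof. by exists [::] => // r; rewrite in_nil. Qed.

Lemma geigP X a v w : geig X v -> geig X w -> geig X (a *: v + w).
Proof.
move=> [rs rsX kv] [rs' rsX' kw]; exists (rs ++ rs').
  by move=> r; rewrite mem_cat => /orP[/rsX|/rsX'].
by rewrite kill_cat killD killZ kv scaler0 add0r kill_catC kw kill0.
Qed.

Lemma geigZ X a v : geig X v -> geig X (a *: v).
Proof. by move=> /(geigP a)/(_ (geig0 X)); rewrite addr0. Qed.

Lemma geigD X v w : geig X v -> geig X w -> geig X (v + w).
Proof. by move=> /(geigP 1) h /h; rewrite scale1r. Qed.

Lemma geigB X v w : geig X v -> geig X w -> geig X (v - w).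
Proof. by move=> gv gw; rewrite addrC -scaleN1r; apply: geigP. Qed.

Lemma geigS X Y v : (X `<=` Y)%classic -> geig X v -> geig Y v.
Proof. by move=> sXY [rs rsX kv]; exists rs => // r /rsX /sXY. Qed.

(** By induction [A v - r *: v] vanishes, so each factor for [t] in [rs'] only rescales [v] by the
    nonzero [r - t]. *)
Lemma geig_disjoint X Y v : (forall r, X r -> ~ Y r) -> geig X v -> geig Y v -> v = 0.
Proof.
move=> dXY [rs rsX kv] [rs' rsY kv'].
elim: rs rsX v kv kv' => [//|r rs IH] rsX v kv kv'.
have Xr : X r by apply: rsX; rewrite mem_head.
have /eqP : A v - r *: v = 0.
  apply: IH => //; first by move=> t trs; apply: rsX; rewrite inE trs orbT.
  by rewrite killB killZ -kill_im kv' linear0 scaler0 subr0.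
rewrite subr_eq0 => /eqP Av.
have rY t : t \in rs' -> r != t.
  by move=> /rsY Yt; apply/eqP => rt; apply: (dXY r); rewrite // rt.
elim: rs' {IH rsY} rY kv' => [//|t rs' IH'] rY /=.
rewrite Av -scalerBl killZ => /eqP; rewrite scaler_eq0 subr_eq0 (negPf (rY _ (mem_head _ _))) /=.
by move=> /eqP; apply: IH' => u us; apply: rY; rewrite inE us orbT.
Qed.

Variable Q : L -> Prop.
Hypothesis QP : forall a v w, Q v -> Q w -> Q (a *: v + w).
Hypothesis QA : forall v, Q v -> Q (A v).

Let QB r v w : Q v -> Q w -> Q (v - r *: w).
Proof. by move=> Qv Qw; rewrite addrC -scaleNr; apply: QP. Qed.

Let QZ a v : Q v -> Q (a *: v).
Proof. by move=> Qv; rewrite -[a](subrK 1) scalerDl scale1r; apply: QP. Qed.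

(** Induct on the list: if [z] solves the equation for [A w - t *: w], then [A - r] sends [w - z] to
    [(t - r) *: w], and [t - r] is invertible. *)
Lemma geig_surj Y r w : ~ Y r -> Q w -> geig Y w ->
  exists v, [/\ Q v, geig Y v & A v - r *: v = w].
Proof.
move=> nYr Qw [rs rsY kw]; elim: rs rsY w Qw kw => [|t rs IH] rsY w Qw kw.
  have Yw : geig Y w by exists [::].
  exists w; split=> //; move: kw => /= ->.
  by rewrite linear0 scaler0 subr0.
have Yt : Y t by apply: rsY; rewrite mem_head.
have [||z [Qz Yz ez]] := IH _ (A w - t *: w) _ kw.
- by move=> u us; apply: rsY; rewrite inE us orbT.
- by apply: QB => //; apply: QA.
have tr : t - r != 0.
  by rewrite subr_eq0; apply/eqP => tr; apply: nYr; rewrite -tr.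
exists ((t - r)^-1 *: (w - z)); split.
- by apply: QZ; rewrite -[z]scale1r; apply: QB.
- by apply: geigZ; apply: geigB => //; exists (t :: rs).
- have {}ez : A z = A w - t *: w + r *: z by rewrite -ez subrK.
  rewrite linearZ /= [A _]linearB /= ez scalerA mulrC -scalerA -scalerBr.
  rewrite [r *: (_ - _)]scalerBr !opprD !opprK !addrA addrN add0r -addrA [- _ + _]addrC addrA.
  by rewrite subrK -scalerBl scalerA mulVf ?scale1r.
Qed.

(** Peel off a factor [A - r], with [r] in [X] by symmetry. The [Y]-part of [A v - r *: v] is the
    image under [A - r] of some [z] in [geig Y], so [A - r] sends [v - z] into [geig X]. *)
Lemma geig_split X Y v : (forall r, X r -> ~ Y r) -> Q v -> geig (X `|` Y) v ->
  exists x y, [/\ Q x, geig X x, Q y, geig Y y & v = x + y].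
Proof.
move=> + Qv [rs + kv].
elim: rs X Y v Qv kv => [|r rs IH] X Y v Qv kv dXY rsXY.
  exists v, 0; split; rewrite ?addr0 //.
  - by exists [::].
  - by rewrite -(scale0r v); apply: QZ.
  - exact: geig0.
wlog Xr : X Y dXY rsXY / X r => [hwlog|].
  have [Xr|Yr] := rsXY r (mem_head _ _); first exact: hwlog.
  have [|t /rsXY []|//|y [x [Qy gy Qx gx e]]] := hwlog Y X.
  - by move=> t Yt Xt; apply: (dXY t).
  - by right.
  - by left.
  by exists x, y; rewrite addrC.
have [||//|t trs|x [y [Qx gx Qy gy e]]] := IH X Y (A v - r *: v).
- by apply: QB => //; apply: QA.
- exact: kv.
- by apply: rsXY; rewrite inE trs orbT.
have [z [Qz gz ez]] := geig_surj (dXY r Xr) Qy gy.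
exists (v - z), z; split; rewrite ?subrK //.
  by rewrite -[z]scale1r; apply: QB.
case: gx => xs xsX kx; exists (r :: xs).
  by move=> t; rewrite inE => /predU1P[->|/xsX].
rewrite /= [A _]linearB /= scalerBr opprD opprK addrACA [- A z + _]addrC.
by rewrite -(opprB (A z)) ez e addrK.
Qed.

End GeneralizedEigen.

(** * Lie algebras *)

Section LieBasics.
Variables (K : fieldType) (L : lieAlgType K).
Implicit Types (x y z h : L).

HB.instance Definition _ x :=
  GRing.isLinear.Build K L L *:%R (lie x) (fun a => lie_linearr a x).

Lemma lieDl x y z : lie (x + y) z = lie x z + lie y z.
Proof. by have := lie_linearl 1 x y z; rewrite !scale1r. Qed.

Lemma lie0l x : lie 0 x = 0.
Proof. by apply: (addrI (lie 0 x)); rewrite -lieDl !addr0. Qed.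

Lemma lieZl a x y : lie (a *: x) y = a *: lie x y.
Proof. by have := lie_linearl a x 0 y; rewrite lie0l !addr0. Qed.

Lemma lieC x y : lie x y = - lie y x.
Proof.
apply/eqP; rewrite -addr_eq0; have := liexx (x + y).
by rewrite lieDl !linearD /= !liexx add0r addr0 => ->.
Qed.

Lemma lie_der x y z : lie x (lie y z) = lie (lie x y) z + lie y (lie x z).
Proof.
have /eqP := lie_jacobi x y z; rewrite -addrA addr_eq0 => /eqP ->.
by rewrite [lie (lie x y) z]lieC [lie z x]lieC linearN /= opprD opprK addrC.
Qed.

(** [ad h - (r + t)] sends [[x, y]] to [[(ad h - r) x, y] + [x, (ad h - t) y]], and each term has
    one shorter list; hence the induction on the total length. *)
Lemma geig_lie h (X Y Z : set K) x y : (forall r t, X r -> Y t -> Z (r + t)) ->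
  geig (lie h) X x -> geig (lie h) Y y -> geig (lie h) Z (lie x y).
Proof.
move=> XYZ [rs rsX kx] [ts tsY ky].
have [m] := ubnP (size rs + size ts).
elim: m rs ts rsX tsY x y kx ky => // m IH [|r rs] [|t ts] rsX tsY x y kx ky.
- by move: kx => /= ->; rewrite lie0l; exists [::].
- by move: kx => /= ->; rewrite lie0l; exists [::].
- by move: ky => /= ->; rewrite linear0; exists [::].
rewrite /= addnS ltnS addSn => lt_m.
have XW : forall u, u \in rs -> X u by move=> u us; apply: rsX; rewrite inE us orbT.
have YW : forall u, u \in ts -> Y u by move=> u us; apply: tsY; rewrite inE us orbT.
have g1 : geig (lie h) Z (lie (lie h x - r *: x) y).
  by apply: (IH rs (t :: ts)); rewrite //= addnS.
have g2 : geig (lie h) Z (lie x (lie h y - t *: y)).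
  by apply: (IH (r :: rs) ts).
have [us usZ kus] := geigD g1 g2.
exists (r + t :: us).
  move=> u; rewrite inE => /predU1P[->|/usZ//].
  by apply: XYZ; [apply: rsX|apply: tsY]; rewrite mem_head.
rewrite /= -kus; congr kill.
rewrite lie_der lieDl -(scaleNr r) lieZl scaleNr [lie x (_ - _)]linearB /=.
by rewrite [lie x (t *: y)]linearZ /= scalerDl opprD addrACA.
Qed.

End LieBasics.

(** The component of [v] over [Y] minus [X] is [v] less its component over the intersection, so it
    also lies in [geig A X] and vanishes by disjointness. *)
Lemma geigI (K : fieldType) (L : lmodType K) (A : {linear L -> L}) (X Y : set K) v :
  geig A X v -> geig A Y v -> geig A (X `&` Y) v.
Proof.
move=> gX gY; have : geig A ((X `&` Y) `|` (Y `\` X)) v.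
  by apply: geigS gY => r Yr; have [Xr|] := pselect (X r); [left|right].
case/(@geig_split _ _ A (fun=> True)) => // [r [Xr _] [_ /(_ Xr)]//|].
move=> a [b [_ ga _ gb e]].
suff b0 : b = 0 by rewrite e b0 addr0.
apply: (geig_disjoint (X := X) (Y := Y `\` X)) gb => [r Xr [_ /(_ Xr)]//|].
have -> : b = v - a by rewrite e addrC addKr.
by apply: geigB => //; apply: geigS ga => r [].
Qed.

(** Cayley-Hamilton: [s] lists the roots of the characteristic polynomial of [A], which splits over
    a closed field. *)
Lemma kill_all (K : closedFieldType) (L : vectType K) (A : {linear L -> L}) :
  exists s, forall v, kill A s v = 0.
Proof.
have := vbasisP {:L}; move: (vbasis _); case: (\dim _) => [|n] e eb.
  exists [::] => v /=; apply/eqP.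
  by have := memvf v; rewrite -(span_basis eb) tuple0 span_nil memv0.
pose M := \matrix_(i < n.+1, j < n.+1) coord e j (A e`_i); pose rho v := \row_j coord e j v.
have rhoA v : rho (A v) = rho v *m M.
  apply/rowP => j; rewrite !mxE [v in LHS](coord_basis eb (memvf v)) !linear_sum.
  by apply: eq_bigr => i _; rewrite !linearZ !mxE.
have rhok rs v : rho (kill A rs v) = rho v *m horner_mx M (\prod_(z <- rs) ('X - z%:P)).
  elim: rs v => [|r rs IH] v /=; first by rewrite big_nil rmorph1 mulmx1.
  rewrite IH big_cons rmorphM mulmxA rmorphB /= horner_mx_X horner_mx_C mulmxBr.
  rewrite -rhoA mul_mx_scalar; congr (_ *m _); apply/rowP => j.
  by rewrite !mxE linearB linearZ.
have [s es] := closed_field_poly_normal (char_poly M).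
exists s => v; have /rowP rho0 : rho (kill A s v) = 0.
  rewrite rhok; move: es; rewrite (monicP (char_poly_monic M)) scale1r => <-.
  by rewrite Cayley_Hamilton mulmx0.
rewrite (coord_basis eb (memvf (kill A s v))) big1 // => i _.
by have := rho0 i; rewrite !mxE => ->; rewrite scale0r.
Qed.

Lemma geig_ad_nil (K : fieldType) (L : lieAlgType K) (h u : L) (s : seq K) (C : set K) :
    (forall v, kill (lie h) s v = 0) ->
    (forall r t, C r -> C t -> C (r + t)) -> ~ C 0 -> geig (lie h) C u ->
  forall v, exists N, iter N (lie u) v = 0.
Proof.
move=> ks CD C0 gu v; exists (size s).+1.
(* [ad u] raises the weight, hence the number of weights below it. *)
pose rank r := count (fun t => `[< C (r - t) >]) s.
have rankS r t : t \in s -> C (r - t) -> (rank t < rank r)%N.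
  move=> ts Crt.
  (* By transitivity every weight below [t] is below [r]; moreover [t] is below [r] but not below
     itself, so the inequality is strict. *)
  have cI : count (predI (fun u => `[< C (t - u) >]) (pred1 t)) s = 0%N.
    apply/eqP; rewrite -leqn0 leqNgt -has_count.
    by apply/hasP => -[w _ /andP[/asboolP + /eqP wt]]; rewrite wt subrr.
  have := count_predUI (fun u => `[< C (t - u) >]) (pred1 t) s.
  rewrite cI addn0 => cU; apply: (@leq_trans (rank t + count_mem t s)).
    by rewrite -addn1 leq_add2l -has_count has_pred1.
  rewrite -cU; apply: sub_count => w /orP[/asboolP Ctw|/eqP->]; apply/asboolP => //.
  by rewrite -(subrK t r) -addrA; apply: CD.
pose X j := [set r | r \in s /\ (j <= rank r)%N].
have gX j : geig (lie h) (X j) (iter j (lie u) v).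
  elim: j => [|j IH]; first by exists s => // r rs; split.
  have gs : geig (lie h) (fun r => r \in s) (iter j.+1 (lie u) v) by exists s.
  pose Z : set K := [set r | exists t, [/\ t \in s, (j <= rank t)%N & C (r - t)]].
  have gZ : geig (lie h) Z (iter j.+1 (lie u) v).
    by apply: geig_lie gu IH => r t Cr [ts jt]; exists t; split; rewrite ?addrK.
  apply: geigS (geigI gZ gs) => r [[t [ts jt Crt]] rs]; split=> //.
  by apply: leq_ltn_trans jt _; apply: rankS.
(* No rank exceeds [size s], so no eigenvalue is left and the killing list is empty. *)
have [rs rsX krs] := gX (size s).+1.
case: rs rsX krs => [//|r rs] /(_ r (mem_head _ _))[_].
by rewrite leqNgt ltnS count_size.
Qed.

(** * Engel's theorem and induction on subalgebras *)

Section SubalgebraInduction.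
Variables (K : fieldType) (L : finDimLieAlgType K).
Implicit Types (A B M P Q U : {vspace L}) (u v x y : L).

Definition lie_stable M A := forall x y, x \in M -> y \in A -> lie x y \in A.

Definition ad_nil u v := exists N, iter N (lie u) v = 0.

Lemma lie_stable_line u A : (forall y, y \in A -> lie u y \in A) -> lie_stable <[u]> A.
Proof. by move=> uA _ y /vlineP[c ->] Ay; rewrite lieZl memvZ ?uA. Qed.

Lemma subalg_add_line M u : lie_stable M M -> (forall y, y \in M -> lie u y \in M) ->
  lie_stable (M + <[u]>) (M + <[u]>).
Proof.
move=> MM uM _ _ /memv_addP[x Mx [_ /vlineP[c ->] ->]] /memv_addP[y My [_ /vlineP[d ->] ->]].
apply: (subvP (addvSl _ _)).
have -> : lie (x + c *: u) (y + d *: u) = lie x y + (c *: lie u y - d *: lie u x).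
  rewrite lieDl lieZl [lie x _]linearD [lie u _]linearD /= ![lie _ (d *: _)]linearZ /=.
  by rewrite liexx scaler0 addr0 [lie x u]lieC scalerN addrAC addrA.
by apply: memvD; [exact: MM|apply: memvB; apply: memvZ; exact: uM].
Qed.

(* The conclusion of Engel's theorem for the action of [M] on all subquotients [A / B]. *)
Definition engel Q M := forall A B, (A <= Q)%VS -> (B <= A)%VS -> ~~ (A <= B)%VS ->
  lie_stable M A -> lie_stable M B ->
  exists2 a, a \in A /\ a \notin B & forall x, x \in M -> lie x a \in B.

Lemma engel0 Q : engel Q 0.
Proof.
move=> A B _ _ /subvPn[a Aa Ba] _ _; exists a => // x /[!memv0] /eqP ->.
by rewrite lie0l mem0v.
Qed.

(** Take [a] killed by [M] modulo [B] and apply [ad u] until just before the result enters [B]. As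
    [u] normalizes [M], every iterate is still killed by [M] modulo [B]. *)
Lemma engel_add_line Q M u : lie_stable M M -> (forall y, y \in M -> lie u y \in M) ->
  (forall v, v \in Q -> ad_nil u v) -> engel Q M -> engel Q (M + <[u]>).
Proof.
move=> MM uM nilu EM A B AQ BA nAB MuA MuB.
have uMu : u \in (M + <[u]>)%VS by apply/(subvP (addvSr _ _))/memv_line.
have sMu : {subset M <= (M + <[u]>)%VS} by apply/subvP/addvSl.
have uA y : y \in A -> lie u y \in A by apply: MuA.
have uB y : y \in B -> lie u y \in B by apply: MuB.
have MA : lie_stable M A by move=> x y /sMu; apply: MuA.
have MB : lie_stable M B by move=> x y /sMu; apply: MuB.
have [a [Aa Ba] Ma] := EM A B AQ BA nAB MA MB.
have ex_k : exists k, iter k (lie u) a \in B.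
  by have [N eN] := nilu a (subvP AQ _ Aa); exists N; rewrite eN mem0v.
have [[|k] Bk mink] := ex_minnP ex_k; first by rewrite Bk in Ba.
have itA j : iter j (lie u) a \in A /\ forall x, x \in M -> lie x (iter j (lie u) a) \in B.
  elim: j => [|j [Aj Mj]]; first by split.
  split=> [|x Mx] /=; first exact: uA.
  by rewrite lie_der [lie x u]lieC memvD ?Mj ?rpredN ?uM ?uB ?Mj.
exists (iter k (lie u) a) => [|_ /memv_addP[x Mx [_ /vlineP[c ->] ->]]].
  by split; [have [] := itA k|apply/negP => /mink; rewrite ltnn].
by rewrite lieDl lieZl memvD ?memvZ //; have [_ ->] := itA k.
Qed.

Lemma dimv_add_line M u : u \notin M -> \dim (M + <[u]>) = (\dim M).+1.
Proof.
move=> Mu; have u0 : u != 0 by apply: contraNneq Mu => ->; rewrite mem0v.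
rewrite dimv_disjoint_sum ?dim_vline ?u0 ?addn1 //.
apply/eqP; rewrite -subv0; apply/subvP => v; rewrite memv_cap memv0 => /andP[Mv /vlineP[c ev]].
move: Mv; rewrite ev; have [->|c0] := eqVneq c 0; first by rewrite scale0r.
by rewrite rpredZeq (negPf c0) (negPf Mu).
Qed.

(** Grow [M] one line at a time. Engel's property for [M] acting on [U / M] supplies [u] outside [M]
    with [[M, u]] inside [M], and it passes to [M + <[u]>], so it is part of the induction. *)
Lemma ad_nil_subalg_ind U (I : {vspace L} -> Prop) :
  lie_stable U U -> (forall u v, u \in U -> v \in U -> ad_nil u v) -> I 0%VS ->
  (forall M u, (M <= U)%VS -> u \in U -> u \notin M -> lie_stable M M ->
     (forall y, y \in M -> lie u y \in M) -> I M -> I (M + <[u]>)%VS) ->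
  I U.
Proof.
move=> UU nilU I0 IS.
suff H j : (j <= \dim U)%N ->
    exists M, [/\ (M <= U)%VS, \dim M = j, lie_stable M M, engel U M & I M].
  have [M [MU dM _ _ IM]] := H _ (leqnn _).
  by move/eqP: dM; rewrite (dimv_leqif_eq MU).2 => /eqP <-.
elim: j => [_|j IH ltj].
  exists 0%VS; split; rewrite ?sub0v ?dimv0 //; last exact: engel0.
  by move=> x y _ /[!memv0] /eqP ->; rewrite linear0.
have [M [MU dM MM EM IM]] := IH (ltnW ltj).
have nUM : ~~ (U <= M)%VS by apply: contraTN ltj => /dimvS; rewrite dM -leqNgt.
have MU' : lie_stable M U by move=> x y /(subvP MU); apply: UU.
have [u [Uu Mu] Mlie] := EM U M (subvv _) MU nUM MU' MM.
have uM y : y \in M -> lie u y \in M by move=> My; rewrite lieC rpredN Mlie.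
exists (M + <[u]>)%VS; split.
- by rewrite subv_add MU -memvE.
- by rewrite dimv_add_line ?dM.
- exact: subalg_add_line.
- by apply: engel_add_line => // v; apply: nilU.
- exact: IS.
Qed.

End SubalgebraInduction.

Lemma kill_nseq0 (K : fieldType) (L : lmodType K) (A : {linear L -> L}) (rs : seq K) v :
  (forall r, r \in rs -> r = 0) -> kill A rs v = iter (size rs) A v.
Proof.
elim: rs v => // r rs IH v rs0; rewrite /= IH => [|t trs].
  by rewrite (rs0 r (mem_head _ _)) scale0r subr0 -iterSr.
by apply: rs0; rewrite inE trs orbT.
Qed.

Lemma subalg_ind (K : closedFieldType) (charK : [pchar K] =i pred0)
    (L : finDimLieAlgType K) (I : {vspace L} -> Prop) :
  I 0%VS ->
  (forall P U : {vspace L}, lie_stable U U -> lie_stable (P + U) (P + U) ->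
     (P :&: U = 0)%VS -> (forall u v, u \in U -> v \in (P + U)%VS -> ad_nil u v) ->
     I P -> I (P + U)%VS) ->
  forall Q, lie_stable Q Q -> I Q.
Proof.
move=> I0 Iext Q; have [m] := ubnP (\dim Q); elim: m Q => // m IH Q ltQm QQ.
have [nilQ|] := pselect (forall u v, u \in Q -> v \in Q -> ad_nil u v).
  by rewrite -[Q]add0v; apply: (Iext); rewrite ?add0v ?cap0v.
move=> /existsNP[h /existsNP[v0 /not_implyP[Qh /not_implyP[Qv0 nnil]]]].
have QP a v w : v \in Q -> w \in Q -> a *: v + w \in Q.
  by move=> Qv Qw; rewrite memvD ?memvZ.
have Qlie v : v \in Q -> lie h v \in Q by apply: QQ.
have exW (X : set K) : {W : {vspace L} | forall v, v \in W <-> v \in Q /\ geig (lie h) X v}.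
  apply: cid; apply: vspace_of_pred; first by split; [exact: mem0v|exact: geig0].
  by move=> a v w [Qv gv] [Qw gw]; split; [exact: QP|exact: geigP].
pose W X := sval (exW X).
have WP X v : v \in W X <-> v \in Q /\ geig (lie h) X v by apply: (svalP (exW X)).
have WW (X Y Z : set K) : (forall r t, X r -> Y t -> Z (r + t)) ->
    forall v w, v \in W X -> w \in W Y -> lie v w \in W Z.
  move=> XYZ v w /WP[Qv gv] /WP[Qw gw]; apply/WP; split; first exact: QQ.
  exact: geig_lie gv gw.
have WU X Y : (forall r, X r -> ~ Y r) -> (W X + W Y)%VS = W (X `|` Y).
  move=> dXY; apply/vspaceP => v; apply/idP/idP.
    move=> /memv_addP[x /WP[Qx gx] [y /WP[Qy gy] ->]]; apply/WP.
    by split; [exact: memvD|apply: geigD; [apply: geigS gx => r; left|apply: geigS gy => r; right]].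
  move=> /WP[Qv gv]; have [x [y [Qx gx Qy gy ->]]] := geig_split QP Qlie dXY Qv gv.
  by apply: memv_add; apply/WP.
have WI X Y : (forall r, X r -> ~ Y r) -> (W X :&: W Y = 0)%VS.
  move=> dXY; apply/eqP; rewrite -subv0; apply/subvP => v.
  rewrite memv_cap => /andP[/WP[_ gx] /WP[_ gy]].
  by rewrite (geig_disjoint dXY gx gy) mem0v.
have [s ks] := kill_all (lie h); have [C [CD C0 Cs]] := total_cone charK s.
have C'D r t : C (- r) -> C (- t) -> C (- (r + t)) by rewrite opprD; apply: CD.
have nilC (D : set K) : (forall x y, D x -> D y -> D (x + y)) -> ~ D 0 ->
    forall u v, u \in W D -> ad_nil u v.
  by move=> DD D0 u v /WP[_ gu]; apply: geig_ad_nil gu v.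
pose Z : set K := [set 0]; pose Cm : set K := [set r | C (- r)].
have d1 r : Z r -> ~ C (- r) by move=> ->; rewrite oppr0.
have d2 r : (Z `|` Cm) r -> ~ C r.
  by move=> [->//|Cr] Cr'; apply: C0; rewrite -(subrr r); apply: CD.
have eQ : Q = (W Z + W Cm + W C)%VS.
  rewrite WU // WU //; apply/vspaceP => v; apply/idP/idP => [Qv|/WP[]//].
  apply/WP; split=> //; exists s => // r /Cs[->|Cr|Cr]; by [do 2!left|right|left; right].
have I1 : I (W Z).
  apply: IH; last by apply: WW => r t -> ->; rewrite addr0.
  move: ltQm; rewrite ltnS; apply: leq_trans.
  (* [W Z] misses [v0]: a list of zeros kills only what some power of [ad h] kills. Hence its
     dimension is below that of [Q]. *)
  have W0Q : (W Z <= Q)%VS by apply/subvP => v /WP[].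
  rewrite (ltn_leqif (dimv_leqif_sup W0Q)); apply/negP => /subvP/(_ _ Qv0)/WP[_].
  by move=> [rs rs0]; rewrite kill_nseq0 // => e; apply: nnil; exists (size rs).
(* The sum is peeled from the right: [W C] extends [W Z + W Cm], which in turn extends [W Z]. *)
rewrite eQ; apply: (Iext).
- exact: WW CD.
- by rewrite -eQ.
- by rewrite WU //; apply: WI.
- by move=> u v Wu _; apply: nilC Wu.
apply: (Iext) => //.
- by apply: WW => r t; apply: C'D.
- rewrite WU //; apply: WW => r t [->|Cr] [->|Ct]; rewrite ?addr0 ?add0r;
    by [left|right|right; apply: C'D].
- exact: WI.
- move=> u v Wu _; apply: nilC Wu => //; by rewrite /Cm /= oppr0.
Qed.

(** * Truncated exponentials of derivations *)

(** A truncated Cauchy product: the antidiagonals below [N + N] cover the square of side [N], and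
    the other terms on them vanish. *)
Lemma sum_triangle (V : nmodType) (f : nat -> nat -> V) N :
  (forall i j, (N <= i)%N || (N <= j)%N -> f i j = 0) ->
  \sum_(j < N + N) \sum_(i < j.+1) f (j - i)%N i = \sum_(i < N) \sum_(j < N) f i j.
Proof.
move=> f0.
transitivity (\sum_(0 <= j < N + N) \sum_(0 <= i < N + N | (i < j.+1)%N) f (j - i)%N i).
  rewrite big_mkord; apply: eq_bigr => j _.
  by rewrite -(big_nat_widen 0 j.+1 _ xpredT (fun i => f (j - i)%N i)) ?big_mkord.
transitivity (\sum_(0 <= i < N) \sum_(0 <= j < N) f j i); last first.
  by rewrite exchange_big_nat big_mkord; apply: eq_bigr => i _; rewrite big_mkord.
rewrite (exchange_big_dep_nat xpredT) //= (big_cat_nat (leq0n N) (leq_addr N N)) /=.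
rewrite [X in _ + X]big_nat [X in _ + X]big1 => [|i /andP[lei _]].
  rewrite addr0 big_nat [RHS]big_nat; apply: eq_bigr => i /= ltiN.
  rewrite -(big_nat_widenl i 0 _ xpredT) // -{1}[i]add0n big_addn.
  under eq_bigr do rewrite addnK.
  have leN : (N <= N + N - i)%N by rewrite -addnBA ?leq_addr // ltnW.
  rewrite (big_cat_nat _ leN) //= [X in _ + X]big_nat [X in _ + X]big1 ?addr0 // => j /andP[lej _].
  by rewrite f0 // lej.
by apply: big1 => j _; rewrite f0 // lei orbT.
Qed.

Section Exponential.
Variables (R : comNzRingType) (M : lmodType R) (D : {linear M -> M}).

Lemma iter_linear j a v w : iter j D (a *: v + w) = a *: iter j D v + iter j D w.
Proof. by elim: j => //= j ->; rewrite linearP. Qed.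

Lemma iterD0 j : iter j D 0 = 0.
Proof. by elim: j => //= j ->; rewrite linear0. Qed.

Lemma iterD_ge j k v : (k <= j)%N -> iter k D v = 0 -> iter j D v = 0.
Proof. by move=> /subnK <-; rewrite iterD => ->; rewrite iterD0. Qed.

Variable br : M -> M -> M.
Hypothesis brDl : forall a v v' w, br (a *: v + v') w = a *: br v w + br v' w.
Hypothesis brDr : forall a v w w', br v (a *: w + w') = a *: br v w + br v w'.
Hypothesis D_der : forall v w, D (br v w) = br (D v) w + br v (D w).

Lemma leibniz j v w :
  iter j D (br v w) = \sum_(i < j.+1) br (iter (j - i) D v) (iter i D w) *+ 'C(j, i).
Proof.
elim: j => [|j IH]; first by rewrite big_ord_recl big_ord0 bin0 subn0 addr0.
rewrite iterS IH linear_sum /=.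
under eq_bigr do rewrite raddfMn /= D_der mulrnDl.
rewrite big_split [in RHS]big_ord_recl /=.
under [in RHS]eq_bigr do rewrite /= subSS binS mulrnDr.
rewrite big_split /= addrA; congr (_ + _).
rewrite big_ord_recl [in RHS]big_ord_recr /= !bin0 !subn0 bin_small // mulr0n addr0.
by congr (_ + _); apply: eq_bigr => i _; rewrite -iterS subnSK.
Qed.

(* [c j] plays the role of [t ^ j / j!]. *)
Variable c : nat -> R.
Hypothesis c0 : c 0%N = 1.
Hypothesis cM : forall i j, c i * c j = c (i + j)%N *+ 'C(i + j, j).

Definition expD N v := \sum_(j < N) c j *: iter j D v.

Lemma expDP N a v w : expD N (a *: v + w) = a *: expD N v + expD N w.
Proof.
rewrite /expD scaler_sumr -big_split; apply: eq_bigr => j _.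
by rewrite iter_linear scalerDr !scalerA mulrC.
Qed.

Lemma expD_widen N N' v : (N <= N')%N -> iter N D v = 0 -> expD N' v = expD N v.
Proof.
move=> leN vN; rewrite /expD [RHS](big_ord_widen N' (fun j => c j *: iter j D v)) //.
rewrite [RHS]big_mkcond; apply: eq_bigr => j _; case: ltnP => // lej.
by rewrite (iterD_ge lej) ?scaler0.
Qed.

(** The exponential of a nilpotent derivation respects brackets: the Leibniz formula and the product
    rule of [c] turn the series of the bracket into a Cauchy product. *)
Lemma expD_br N v w : iter N D v = 0 -> iter N D w = 0 -> iter N D (br v w) = 0 ->
  expD N (br v w) = br (expD N v) (expD N w).
Proof.
(* Passing from [N] to [N + N] adds only zero terms and makes room for all antidiagonals. *)
move=> vN wN brN; rewrite -(expD_widen (leq_addr N N) brN).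
have brl0 x : br 0 x = 0 by have := brDl (-1) 0 0 x; rewrite scaler0 addr0 scaleN1r addNr.
have brr0 x : br x 0 = 0 by have := brDr (-1) x 0 0; rewrite scaler0 addr0 scaleN1r addNr.
pose f i j := br (c i *: iter i D v) (c j *: iter j D w).
transitivity (\sum_(i < N) \sum_(j < N) f i j).
  rewrite -sum_triangle => [|i j /orP[] le]; rewrite /f.
  - rewrite /expD; apply: eq_bigr => j _; rewrite leibniz scaler_sumr.
    apply: eq_bigr => i _.
    have -> a b x y : br (a *: x) (b *: y) = (a * b) *: br x y.
      by rewrite -[a *: x]addr0 brDl brl0 addr0 -[b *: y]addr0 brDr brr0 addr0 scalerA.
    by rewrite cM subnK ?leq_ord // -scalerMnr -scalerMnl.
  - by rewrite (iterD_ge le vN) scaler0 brl0.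
  - by rewrite (iterD_ge le wN) scaler0 brr0.
have suml I (s : seq I) (F : I -> M) x : br (\sum_(i <- s) F i) x = \sum_(i <- s) br (F i) x.
  elim: s => [|i s IH]; rewrite ?big_nil // !big_cons -IH -[F i]scale1r brDl.
  by rewrite !scale1r.
have sumr I (s : seq I) (F : I -> M) x : br x (\sum_(i <- s) F i) = \sum_(i <- s) br x (F i).
  elim: s => [|i s IH]; rewrite ?big_nil // !big_cons -IH -[F i]scale1r brDr.
  by rewrite !scale1r.
by rewrite /expD suml; apply: eq_bigr => i _; rewrite sumr.
Qed.

Lemma expD_fix N v : D v = 0 -> expD N.+1 v = v.
Proof.
move=> Dv; rewrite /expD big_ord_recl c0 scale1r big1 ?addr0 // => j _.
by rewrite lift0 iterSr Dv iterD0 scaler0.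
Qed.

Lemma expD_stable N (T : M -> Prop) v : T 0 ->
    (forall a x y, T x -> T y -> T (a *: x + y)) -> (forall x, T x -> T (D x)) ->
  T v -> T (expD N v).
Proof.
move=> T0 TP TD Tv; rewrite /expD; elim/big_ind: _ => // [x y Tx Ty|j _].
  by rewrite -[x]scale1r; apply: TP.
rewrite -[_ *: _]addr0; apply: TP => //.
by elim: (j : nat) => //= i; apply: TD.
Qed.

(* [expD N] is unipotent on [T]: if [iter k.+1 D v = 0] then [expD N v - v] is
   killed by [iter k D], which drives the induction. *)
Lemma expD_onto N (T S : M -> Prop) :
    T 0 -> (forall a x y, T x -> T y -> T (a *: x + y)) -> (forall x, T x -> T (D x)) ->
    (forall x, T x -> iter N D x = 0) ->
    S 0 -> (forall a x y, S x -> S y -> S (a *: x + y)) ->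
    (forall x, T x -> S (expD N x)) ->
  forall x, T x -> S x.
Proof.
move=> T0 TP TD; case: N => [T1 S0 _ _ x /T1 /= -> //|N] TN S0 SP TS x Tx.
(* The nilpotency index [k] varies in the induction while the truncation stays at [N.+1]. *)
have := TN x Tx; move: (N.+1) => k; elim: k x Tx => [|k IH] x Tx xk; first by move: xk => /= ->.
have [r er Tr] : exists2 r, expD N.+1 x = x + r & T r /\ iter k D r = 0.
  exists (\sum_(j < N) c j.+1 *: iter j.+1 D x).
    by rewrite /expD big_ord_recl c0 scale1r.
  elim/big_ind: _ => [|y z [Ty ky] [Tz kz]|j _]; first by split; rewrite ?iterD0.
    split; first by rewrite -[y]scale1r; apply: TP.
    by rewrite -[y]scale1r iter_linear ky kz scaler0 addr0.
  split; last first.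
    rewrite -[_ *: _]addr0 iter_linear iterD0 addr0 -iterD addnS -addSn addnC.
    by rewrite iterD xk iterD0 scaler0.
  rewrite -[_ *: _]addr0; apply: TP => //.
  by elim: (j.+1) => //= i; apply: TD.
have -> : x = (-1) *: r + expD N.+1 x by rewrite er scaleN1r addrCA addNr addr0.
by apply: SP; [apply: IH; case: Tr|apply: TS].
Qed.

End Exponential.

(** * Extension of scalars *)

Section Tensor.
Variables (K : fieldType) (L : finDimLieAlgType K) (n : nat) (e : n.-tuple L).
Hypothesis eb : basis_of {:L} e.
Local Notation R := {mpoly K[n]}.
Local Notation M := 'rV[R]_n.
Implicit Types (x y u : L) (v w : M).

(* The coordinate embedding of [L] into its extension of scalars [M = R (x) L]. *)
Definition iota x : M := \row_i (coord e i x)%:MP.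

(** The bracket of [L] extended bilinearly over [R]. *)
Definition bra v w : M := \sum_i \sum_j (v 0 i * w 0 j) *: iota (lie e`_i e`_j).

Lemma iotaP a x y : iota (a *: x + y) = a%:MP *: iota x + iota y.
Proof. by apply/rowP => i; rewrite !mxE linearP mpolyCD mpolyCM. Qed.

Lemma iota0 : iota 0 = 0.
Proof. by apply/rowP => i; rewrite !mxE linear0 mpolyC0. Qed.

Lemma iotaD x y : iota (x + y) = iota x + iota y.
Proof. by have := iotaP 1 x y; rewrite mpolyC1 !scale1r. Qed.

Lemma iota_sum I (s : seq I) (F : I -> L) : iota (\sum_(i <- s) F i) = \sum_(i <- s) iota (F i).
Proof.
elim: s => [|i s IH]; first by rewrite !big_nil iota0.
by rewrite !big_cons iotaD IH.
Qed.

Lemma iotaZ a x : iota (a *: x) = a%:MP *: iota x.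
Proof. by have := iotaP a x 0; rewrite iota0 !addr0. Qed.

Lemma row_iota v : v = \sum_i v 0 i *: iota e`_i.
Proof.
apply/rowP => j; rewrite summxE (bigD1 j) //= !mxE !coord_free ?(basis_free eb) //.
rewrite eqxx mpolyC1 mulr1 big1 ?addr0 // => i ij.
by rewrite !mxE coord_free ?(basis_free eb) // (negPf ij) mpolyC0 mulr0.
Qed.

Lemma tensor_ind (P : M -> Prop) :
  (forall a v w, P v -> P w -> P (a *: v + w)) -> (forall x, P (iota x)) -> forall v, P v.
Proof.
move=> PP Pi v; rewrite [v]row_iota; elim/big_ind: _ => [|x y Px Py|i _].
- by have := Pi 0; rewrite iota0.
- by rewrite -[x]scale1r; apply: PP.
- by rewrite -[_ *: _]addr0; apply: PP => //; have := Pi 0; rewrite iota0.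
Qed.

Lemma braPl w a v v' : bra (a *: v + v') w = a *: bra v w + bra v' w.
Proof.
rewrite /bra scaler_sumr -big_split; apply: eq_bigr => i _ /=.
rewrite scaler_sumr -big_split; apply: eq_bigr => j _ /=.
by rewrite !mxE mulrDl scalerDl scalerA mulrA.
Qed.

Lemma braPr v a w w' : bra v (a *: w + w') = a *: bra v w + bra v w'.
Proof.
rewrite /bra scaler_sumr -big_split; apply: eq_bigr => i _ /=.
rewrite scaler_sumr -big_split; apply: eq_bigr => j _ /=.
by rewrite !mxE mulrDr scalerDl scalerA mulrCA.
Qed.

HB.instance Definition _ v := GRing.isLinear.Build R M M *:%R (bra v) (braPr v).

Lemma braDl v v' w : bra (v + v') w = bra v w + bra v' w.
Proof. by rewrite -{1}[v]scale1r braPl scale1r. Qed.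

Lemma bra0l w : bra 0 w = 0.
Proof. by apply: (addrI (bra 0 w)); rewrite -braDl !addr0. Qed.

Lemma braZl a v w : bra (a *: v) w = a *: bra v w.
Proof. by rewrite -[a *: v]addr0 braPl bra0l addr0. Qed.

Lemma braZr v a w : bra v (a *: w) = a *: bra v w.
Proof. exact: linearZ. Qed.

Lemma bra_sumr v I (s : seq I) (F : I -> M) :
  bra v (\sum_(i <- s) F i) = \sum_(i <- s) bra v (F i).
Proof. exact: linear_sum. Qed.

Lemma bra_suml w I (s : seq I) (F : I -> M) :
  bra (\sum_(i <- s) F i) w = \sum_(i <- s) bra (F i) w.
Proof.
elim: s => [|i s IH]; first by rewrite !big_nil bra0l.
by rewrite !big_cons braDl IH.
Qed.

Lemma bra_iota x y : bra (iota x) (iota y) = iota (lie x y).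
Proof.
have lie_suml (s : seq 'I_n) (F : 'I_n -> L) z :
    lie (\sum_(i <- s) F i) z = \sum_(i <- s) lie (F i) z.
  elim: s => [|i s IH]; first by rewrite !big_nil lie0l.
  by rewrite !big_cons lieDl IH.
rewrite {2}(coord_basis eb (memvf x)) {2}(coord_basis eb (memvf y)) lie_suml iota_sum.
apply: eq_bigr => i _; rewrite linear_sum iota_sum; apply: eq_bigr => j _ /=.
by rewrite lieZl linearZ /= !iotaZ !mxE scalerA.
Qed.

Lemma braC v w : bra v w = - bra w v.
Proof.
elim/tensor_ind: v => [a v v' IH IH'|x].
  by rewrite braPl linearP IH IH' /= opprD scalerN.
elim/tensor_ind: w => [a w w' IH IH'|y].
  by rewrite braPl [bra (iota x) _]linearP /= IH IH' /= opprD scalerN.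
by rewrite !bra_iota lieC -[- lie _ _]scaleN1r iotaZ mpolyCN mpolyC1 scaleN1r.
Qed.

Lemma bra_der u v w : bra (iota u) (bra v w) = bra (bra (iota u) v) w + bra v (bra (iota u) w).
Proof.
elim/tensor_ind: v => [a v v' IH IH'|x].
  rewrite !braPl !linearP /= !braPl IH IH' scalerDr.
  exact: addrACA.
elim/tensor_ind: w => [a w w' IH IH'|y].
  rewrite !linearP /= IH IH' scalerDr.
  exact: addrACA.
by rewrite !bra_iota lie_der iotaD.
Qed.

Lemma iter_bra_iota j u x : iter j (bra (iota u)) (iota x) = iota (iter j (lie u) x).
Proof. by elim: j => //= j ->; rewrite bra_iota. Qed.

Definition dM (k : 'I_n) v : M := map_mx (mderiv k) v.

Lemma dM_is_zmod k : zmod_morphism (dM k).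
Proof. by move=> v w; apply/rowP => i; rewrite !mxE linearB. Qed.

HB.instance Definition _ k := GRing.isZmodMorphism.Build M M (dM k) (dM_is_zmod k).

Lemma dMZ k a v : dM k (a *: v) = mderiv k a *: v + a *: dM k v.
Proof. by apply/rowP => i; rewrite !mxE mderivM. Qed.

Lemma dM_iota k x : dM k (iota x) = 0.
Proof. by apply/rowP => i; rewrite !mxE mderivC. Qed.

Lemma dM_bra_iota k u v : dM k (bra (iota u) v) = bra (iota u) (dM k v).
Proof.
elim/tensor_ind: v => [a v w IHv IHw|x].
  rewrite linearP !raddfD /= !dMZ IHv IHw /=.
  by rewrite [in RHS]linearD /= !linearZ.
by rewrite bra_iota !dM_iota linear0.
Qed.

Inductive rspan (G : set M) : set M :=
| rspan0 : rspan G 0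
| rspan_gen v : G v -> rspan G v
| rspan_lin a v w : rspan G v -> rspan G w -> rspan G (a *: v + w).

Lemma rspan_sub (G G' : set M) v : (forall w, G w -> rspan G' w) -> rspan G v -> rspan G' v.
Proof. by move=> GG'; elim=> *; [exact: rspan0|exact: GG'|exact: rspan_lin]. Qed.

Lemma rspanD G v w : rspan G v -> rspan G w -> rspan G (v + w).
Proof. by move=> Gv Gw; rewrite -[v]scale1r; apply: rspan_lin. Qed.

(* The [R]-submodule [R (x) W] of [M]. *)
Definition tens (W : {vspace L}) : set M := rspan [set iota x | x in [set x | x \in W]].

Lemma tens_iota (W : {vspace L}) x : x \in W -> tens W (iota x).
Proof. by move=> Wx; apply: rspan_gen; exists x. Qed.

Lemma tens_bra (M1 W : {vspace L}) v w :
  lie_stable M1 W -> tens M1 v -> tens W w -> tens W (bra v w).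
Proof.
move=> MW; elim=> {v} [|_ [x Mx <-]|a v v' _ IHv _ IHv'] Ww.
- by rewrite bra0l; apply: rspan0.
- elim: Ww => {w} [|_ [y Wy <-]|a w w' _ IHw _ IHw'].
  + by rewrite linear0; apply: rspan0.
  + by rewrite bra_iota; apply/tens_iota/MW.
  + by rewrite linearP; apply: rspan_lin.
- by rewrite braPl; apply: rspan_lin; [apply: IHv|apply: IHv'].
Qed.

Lemma tens_ad (W : {vspace L}) u w :
  (forall y, y \in W -> lie u y \in W) -> tens W w -> tens W (bra (iota u) w).
Proof.
move=> uW; apply: (tens_bra (M1 := <[u]>)); first exact: lie_stable_line.
exact/tens_iota/memv_line.
Qed.

(** Nilpotency on single elements becomes uniform by taking a maximum over a basis of [W], and
    linearity over [R] carries it to [tens W]. *)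
Lemma tens_nil (W : {vspace L}) u : (forall y, y \in W -> ad_nil u y) ->
  exists N, forall w, tens W w -> iter N.+1 (bra (iota u)) w = 0.
Proof.
move=> nilW.
have [N nilN] : exists N, forall i : 'I_(\dim W), iter N (lie u) (vbasis W)`_i = 0.
  have nilb (i : 'I_(\dim W)) : exists N, iter N (lie u) (vbasis W)`_i = 0.
    by apply: nilW; rewrite vbasis_mem // mem_nth // size_tuple.
  have [N nilN] := choice nilb; exists (\max_i N i) => i.
  by rewrite -(subnK (leq_bigmax i)) iterD nilN iterD0.
have {}nilN x : x \in W -> iter N (lie u) x = 0.
  move=> /coord_vbasis ->; elim/big_ind: _ => [|y z ey ez|i _]; first by rewrite iterD0.
    by rewrite -[y]scale1r iter_linear ey ez scaler0 addr0.
  by rewrite -[_ *: _]addr0 iter_linear nilN iterD0 scaler0 addr0.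
exists N => w; elim=> {w} [|_ [x /nilN ex <-]|a v w _ ev _ ew].
- by rewrite iterD0.
- by rewrite iter_bra_iota iterS ex linear0 iota0.
- by rewrite iter_linear ev ew scaler0 addr0.
Qed.

End Tensor.

(** * Maurer-Cartan forms *)

Section MaurerCartan.
Variables (K : fieldType) (L : finDimLieAlgType K) (n : nat) (e : n.-tuple L).
Hypothesis charK : [pchar K] =i pred0.
Hypothesis eb : basis_of {:L} e.
Local Notation R := {mpoly K[n]}.
Local Notation M := 'rV[R]_n.
Implicit Types (x y u : L) (v w : M) (P Q T U W : {vspace L}).

(** Divided powers of [- X_m], which make [expD] the series of [exp (- x_m ad u)]. *)
Definition divpow (m : 'I_n) j : R := (j`!%:R^-1 : K) *: (- 'X_m) ^+ j.

Lemma fact_neq0 j : j`!%:R != 0 :> K.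
Proof. by rewrite (proj1 (pcharf0P K) charK) -lt0n fact_gt0. Qed.

Lemma divpow0 m : divpow m 0 = 1.
Proof. by rewrite /divpow fact0 invr1 scale1r. Qed.

Lemma divpowM m i j : divpow m i * divpow m j = divpow m (i + j)%N *+ 'C(i + j, j).
Proof.
rewrite /divpow -scalerAl -scalerAr scalerA -exprD scalerMnl; congr (_ *: _).
have := fact_neq0 (i + j); rewrite -(bin_fact (leq_addl i j)) addnK natrM mulf_eq0 negb_or.
move=> /andP[C0 _]; rewrite natrM -[RHS]mulr_natr.
by rewrite !invfM mulrAC mulVf // mul1r mulrC.
Qed.

Lemma mderiv_oppX (k m : 'I_n) : mderiv k (- 'X_m : R) = - (k == m)%:R.
Proof.
rewrite mderivN mderivX mnm1E; have [->|km] := eqVneq m k; last by rewrite scale0r.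
rewrite scale1r -mpolyX0; congr (- 'X_[_]); apply/mnmP => i; rewrite mnmBE subnn mnm0E //.
Qed.

Lemma mderiv_exp (k : 'I_n) (p : R) j : mderiv k (p ^+ j.+1) = (p ^+ j * mderiv k p) *+ j.+1.
Proof.
elim: j => [|j IH]; first by rewrite expr0 mul1r.
by rewrite exprS mderivM IH mulrnAr mulrA -exprS mulrC -mulrS.
Qed.

Lemma mderiv_divpow m k j : k != m -> mderiv k (divpow m j) = 0.
Proof.
move=> km; rewrite mderivZ; case: j => [|j]; first by rewrite expr0 -mpolyC1 mderivC scaler0.
by rewrite mderiv_exp mderiv_oppX (negPf km) oppr0 mulr0 mul0rn scaler0.
Qed.

Lemma mderiv_divpowS m j : mderiv m (divpow m j.+1) = - divpow m j.
Proof.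
rewrite mderivZ mderiv_exp mderiv_oppX eqxx mulrN1 mulNrn scalerN -scalerMnr scalerMnl.
rewrite factS natrM invfM -[_ *+ j.+1]mulr_natr mulrAC mulVf ?mul1r //.
by rewrite (proj1 (pcharf0P K) charK).
Qed.

(* [om] is the [L]-valued form [\sum_i om i dx_i]; it involves only the first [m]
   variables, takes values in [Q], and satisfies the Maurer-Cartan equation. *)
Definition mc_form Q (m : nat) (om : 'I_n -> M) : Prop :=
  [/\ forall i : 'I_n, (m <= i)%N -> om i = 0,
      forall i k : 'I_n, (m <= k)%N -> dM k (om i) = 0,
      forall i j, dM i (om j) - dM j (om i) = - bra e (om i) (om j)
    & forall i, tens e Q (om i)].

(** The constants from [T] are directions that the form may not yet produce; spanning by the form
    alone is the case [T = 0]. *)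
Definition gens (om : 'I_n -> M) T : set M :=
  [set v | (exists i, v = om i) \/ exists2 x, x \in T & v = iota e x].

(** * Derivatives of one exponential factor *)

Section Step.
Variables (u : L) (m : 'I_n) (N : nat).
Local Notation D := (bra e (iota e u)).
Local Notation E := (@expD R M D (divpow m) N.+1).

Lemma dM_iter k j v : dM k (iter j D v) = iter j D (dM k v).
Proof. by elim: j => //= j <-; rewrite dM_bra_iota. Qed.

Lemma dM_exp k v : k != m -> dM k (E v) = E (dM k v).
Proof.
move=> km; rewrite /expD raddf_sum /=; apply: eq_bigr => j _.
by rewrite dMZ dM_iter mderiv_divpow // scale0r add0r.
Qed.

(** Product rule: differentiating the coefficients shifts the series by one and brings out [- D];
    the top term of [D (E v)] is zero by nilpotency. *)
Lemma dM_expm v : iter N.+1 D v = 0 -> dM m (E v) = E (dM m v) - D (E v).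
Proof.
move=> Nv; rewrite /expD raddf_sum /=.
under eq_bigr do rewrite dMZ dM_iter.
rewrite big_split /= addrC; congr (_ + _).
rewrite big_ord_recl divpow0 mderivC scale0r add0r bra_sumr big_ord_recr.
rewrite [X in - (_ + X)]/= braZr -iterS Nv scaler0.
rewrite [X in - X]addr0 -sumrN; apply: eq_bigr => j _.
by rewrite lift0 mderiv_divpowS scaleNr braZr.
Qed.

End Step.

(* The new form is [exp (- x_m ad u) om + u dx_m]. *)
Lemma mc_step Q (m : 'I_n) u om :
    lie_stable Q Q -> u \in Q -> (forall x, x \in Q -> ad_nil u x) -> mc_form Q m om ->
  exists2 om', mc_form Q m.+1 om' &
    forall T W, (forall x, x \in T -> lie u x \in T) -> (forall x, x \in W -> lie u x \in W) ->
      (W <= Q)%VS -> (forall x, x \in W -> rspan (gens om (T + <[u]>)) (iota e x)) ->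
      forall x, x \in W -> rspan (gens om' T) (iota e x).
Proof.
move=> QQ Qu nilu [om0 dom flat tom].
have [N tN] := tens_nil eb nilu.
pose D : {linear M -> M} := bra e (iota e u).
pose E := @expD R M D (divpow m) N.+1.
have EP a v w : E (a *: v + w) = a *: E v + E w by apply: expDP.
have E0 : E 0 = 0 by have := EP (-1) 0 0; rewrite scaler0 addr0 scaleN1r addNr.
have EN v : E (- v) = - E v by have := EP (-1) v 0; rewrite E0 !addr0 !scaleN1r.
have Eu : E (iota e u) = iota e u.
  by apply: expD_fix; [exact: divpow0|rewrite /D /= bra_iota // liexx iota0].
have tE W v : (forall x, x \in W -> lie u x \in W) -> tens e W v -> tens e W (E v).
  move=> uW; apply: expD_stable => [|a x y|x]; [exact: rspan0|exact: rspan_lin|exact: tens_ad].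
pose om' i := if i == m then iota e u else E (om i).
exists om'; last first.
  move=> T W uT uW WQ sp w Ww.
  (* [E] is unipotent on [tens e W], so it is enough to span its values there. It sends [om i] to
     [om' i] for [i] other than [m], where [om] was zero; it fixes [iota e u], which is [om' m], and
     preserves [tens e T]. *)
  apply: (@expD_onto R M D (divpow m) (divpow0 m) N.+1 (tens e W) (rspan (gens om' T))).
  - exact: rspan0.
  - by move=> a x y; apply: rspan_lin.
  - by move=> x; apply: tens_ad.
  - move=> x Wx; apply: tN; apply: rspan_sub Wx => _ [y Wy <-].
    by apply/tens_iota/(subvP WQ).
  - exact: rspan0.
  - by move=> a x y; apply: rspan_lin.
  - move=> v Wv; rewrite -/(E v).
    have : rspan (gens om (T + <[u]>)) v by apply: rspan_sub Wv => _ [y Wy <-]; apply: sp.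
    elim=> {v Wv} [|_ [[i ->]|[x Tx ->]]|a v v' _ IHv _ IHv'].
    + by rewrite E0; apply: rspan0.
    + have [->|im] := eqVneq i m; first by rewrite om0 // E0; apply: rspan0.
      by apply: rspan_gen; left; exists i; rewrite /om' (negPf im).
    + move: Tx => /memv_addP[t Tt [_ /vlineP[k ->] ->]].
      rewrite addrC iotaP EP Eu; apply: rspan_lin.
        by apply: rspan_gen; left; exists m; rewrite /om' eqxx.
      apply: rspan_sub (tE T _ uT (tens_iota e Tt)) => _ [y Ty <-].
      by apply: rspan_gen; right; exists y.
    + by rewrite EP; apply: rspan_lin.
  - exact: tens_iota.
have dE k v : k != m -> dM k (E v) = E (dM k v) by apply: dM_exp.
have dEm v : tens e Q v -> dM m v = 0 -> dM m (E v) = - D (E v).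
  by move=> /tN Nv dv; rewrite dM_expm // dv -/(E 0) E0 add0r.
split.
- move=> i ltmi; rewrite /om' ifF ?om0 ?E0 //; first exact: ltnW.
  by apply/negbTE; rewrite neq_ltn ltmi orbT.
- move=> i k ltmk; rewrite /om'; case: eqP => _; first exact: dM_iota.
  rewrite dE; last by rewrite neq_ltn ltmk orbT.
  by rewrite dom ?E0 // ltnW.
(* If exactly one index is [m], the equation is the derivative of [E] along [x_m], as [iota e u] is
   constant. If neither is, [E] commutes with both derivatives and respects the bracket. *)
- move=> i j; rewrite /om'; have [->|im] := eqVneq i m; have [->|jm] := eqVneq j m.
  + by rewrite subrr bra_iota // liexx iota0 oppr0.
  + by rewrite dEm // ?dom // dM_iota subr0.
  + by rewrite dEm // ?dom // dM_iota sub0r opprK /D /= (braC eb).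
  + rewrite !dE // -[E (dM i _)]scale1r -EN -EP scale1r flat EN; congr (- _).
    apply: expD_br => //.
    * by move=> *; apply: braPl.
    * by move=> *; apply: braPr.
    * exact: bra_der.
    * exact: divpowM.
    * exact: tN.
    * exact: tN.
    * by apply: tN; apply: tens_bra QQ _ _.
- move=> i; rewrite /om'; case: eqP => _; first exact: tens_iota.
  by apply: tE => // x Qx; apply: QQ.
Qed.

End MaurerCartan.

(** * Existence of a spanning Maurer-Cartan form *)

Section Existence.
Variables (K : closedFieldType) (L : finDimLieAlgType K) (n : nat) (e : n.-tuple L).
Hypothesis charK : [pchar K] =i pred0.
Hypothesis eb : basis_of {:L} e.
Implicit Types (P Q T U W : {vspace L}).

Definition mc_spanning Q := exists2 om, mc_form e Q (\dim Q) om &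
  forall x, x \in Q -> rspan (gens e om 0) (iota e x).

Lemma mc_form_sub P Q m om : (P <= Q)%VS -> mc_form e P m om -> mc_form e Q m om.
Proof.
move=> PQ [om0 dom flat tom]; split=> // i.
by apply: rspan_sub (tom i) => _ [x Px <-]; apply/tens_iota/(subvP PQ).
Qed.

Lemma gensS om T T' : (T <= T')%VS -> (gens e om T `<=` gens e om T')%classic.
Proof. by move=> TT' v [|[x Tx ->]]; [left|right; exists x => //; apply: (subvP TT')]. Qed.

Lemma mc_ext P U : lie_stable U U -> lie_stable (P + U) (P + U) -> (P :&: U = 0)%VS ->
  (forall u v, u \in U -> v \in (P + U)%VS -> ad_nil u v) ->
  mc_spanning P -> mc_spanning (P + U).
Proof.
move=> UU QQ PU0 nilU [om0 mc0 sp0]; set Q := (P + U)%VS in QQ nilU *.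
have UQ : (U <= Q)%VS := addvSr _ _.
have dimQ : \dim Q = (\dim P + \dim U)%N by rewrite dimv_disjoint_sum.
have dimQn : (\dim Q <= n)%N.
  by rewrite -(size_tuple e) -(eqnP (basis_free eb)) (span_basis eb) dimvS ?subvf.
(* Along a chain of subalgebras [M] of [U], [P + M] need not be a subalgebra, so
   the spanning of [Q] is only maintained modulo [U]. *)
pose I M := exists2 om, mc_form e Q (\dim P + \dim M) om &
  (forall x, x \in M -> rspan (gens e om 0) (iota e x)) /\
  (forall x, x \in Q -> rspan (gens e om U) (iota e x)).
suff [om mcom [spU spQ]] : I U.
  exists om; first by rewrite dimQ.
  move=> x /spQ; apply: rspan_sub => v [[i ->]|[y /spU Uy ->//]].
  by apply: rspan_gen; left; exists i.
apply: ad_nil_subalg_ind => // [u v Uu Uv||M u MU Uu Mu MM uM [om mcom [spM spQ]]].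
- by apply: nilU => //; apply: (subvP UQ).
- exists om0; first by rewrite dimv0 addn0; apply: mc_form_sub mc0; apply: addvSl.
  split=> [x /[!memv0] /eqP ->|x /memv_addP[p Pp [y Uy ->]]].
    by rewrite iota0; apply: rspan0.
  rewrite iotaD; apply: rspanD.
    by apply: rspan_sub (sp0 _ Pp) => v /(gensS (sub0v U)); apply: rspan_gen.
  by apply: rspan_gen; right; exists y.
have dMu := dimv_add_line Mu.
have ltn_m : (\dim P + \dim M < n)%N.
  apply: leq_trans dimQn; rewrite dimQ ltn_add2l -dMu dimvS // subv_add MU.
  by rewrite -memvE.
have Qu : u \in Q by apply: (subvP UQ).
have [om' mc' sp'] := mc_step (m := Ordinal ltn_m) charK eb QQ Qu (fun x => nilU u x Uu) mcom.
exists om'; first by rewrite dMu addnS.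
(* For [M + <[u]>] take [T = 0], as only [u] was missing and it is now a coefficient. For [Q] take
   [T = U], stable under [ad u] because [U] is a subalgebra. *)
split.
- apply: sp'.
  + by move=> x /[!memv0] /eqP ->; rewrite linear0.
  + by move=> x; apply: subalg_add_line MM uM _ _ _; apply/(subvP (addvSr _ _))/memv_line.
  + by rewrite subv_add (subv_trans MU UQ) -memvE.
  + move=> _ /memv_addP[y My [z uz ->]]; rewrite add0v iotaD; apply: rspanD.
      by apply: rspan_sub (spM _ My) => v /(gensS (sub0v <[u]>)); apply: rspan_gen.
    by apply: rspan_gen; right; exists z.
- apply: sp' => // [x Ux|x Qx|x Qx].
  + exact: UU.
  + exact: QQ.
  + by apply: rspan_sub (spQ _ Qx) => v /(gensS (addvSl U <[u]>)); apply: rspan_gen.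
Qed.

Lemma mc_exists : exists om : 'I_n -> 'rV[{mpoly K[n]}]_n,
  (forall i j, dM i (om j) - dM j (om i) = - bra e (om i) (om j)) /\
  forall v, rspan [set om i | i in [set: 'I_n]] v.
Proof.
have [|||om [_ _ flat _] sp] := @subalg_ind K charK L mc_spanning _ _ {:L}%VS.
- exists (fun=> 0).
    split=> [//|i k _|i j|i].
    + by rewrite raddf0.
    + by rewrite bra0l !raddf0 ?subr0 ?oppr0 ?addr0.
    + exact: rspan0.
  by move=> x /[!memv0] /eqP ->; rewrite iota0; apply: rspan0.
- exact: mc_ext.
- by move=> x y _ _; apply: memvf.
exists om; split=> // v; elim/(tensor_ind eb): v => [a v w|x]; first exact: rspan_lin.
apply: rspan_sub (sp x (memvf x)) => v [[i ->]|[y /[!memv0] /eqP -> ->]].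
  by apply: rspan_gen; exists i.
by rewrite iota0; apply: rspan0.
Qed.

End Existence.

(** * Polynomial vector fields *)

Section DerivationsOfPolynomials.
Variables (K : fieldType) (n : nat).
Local Notation R := {mpoly K[n]}.
Local Notation M := 'rV[R]_n.
Implicit Types (g h : M) (D : derivation K n).

Lemma vfield_subproof g : (fun f => \sum_i g 0 i * mderiv i f) \in @der_pred K n.
Proof.
apply/der_predP; split=> [a f1 f2|f1 f2].
  rewrite scaler_sumr -big_split; apply: eq_bigr => i _ /=.
  by rewrite linearP mulrDr scalerAr.
rewrite mulr_suml mulr_sumr -big_split; apply: eq_bigr => i _ /=.
by rewrite mderivM mulrDr [f1 * (_ * _)]mulrCA [g 0 i * (_ * f2)]mulrA.
Qed.

Definition vfield g : derivation K n := Derivation (vfield_subproof g).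

Lemma vfieldX g i : vfield g 'X_i = g 0 i.
Proof.
rewrite /= (bigD1 i) //= big1 ?addr0 => [|j ji]; rewrite mderivX mnm1E.
  rewrite eqxx scale1r (_ : (_ - _)%MM = 0%MM) ?mpolyX0 ?mulr1 //.
  by apply/mnmP => k; rewrite mnmBE subnn mnm0E.
by rewrite [i == j]eq_sym (negPf ji) scale0r mulr0.
Qed.

Lemma der1 D : D 1 = 0.
Proof.
have := derM D 1 1; rewrite !mulr1 mul1r => /eqP.
by rewrite -subr_eq0 opprD addNKr oppr_eq0 => /eqP.
Qed.

Lemma der_eqX D D' : (forall i, D 'X_i = D' 'X_i) -> D = D'.
Proof.
move=> eqX; apply: derivation_eqP.
have eqM f1 f2 : D f1 = D' f1 -> D f2 = D' f2 -> D (f1 * f2) = D' (f1 * f2).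
  by move=> e1 e2; rewrite !derM e1 e2.
elim/mpolyind => [|c m p _ _ IH]; first by rewrite !linear0.
rewrite !(proj1 (derivationP _)) IH; congr (_ *: _ + _); rewrite mpolyXE_id.
elim/big_ind: _ => [||i _]; [by rewrite !der1|exact: eqM|].
by elim: (m i) => [|k IHk]; rewrite ?expr0 ?der1 // exprS; apply: eqM.
Qed.

Lemma vfield_der D : D = vfield (\row_i D 'X_i).
Proof. by apply: der_eqX => i; rewrite vfieldX mxE. Qed.

Lemma vfield_inj : injective vfield.
Proof. by move=> g h eq_gh; apply/rowP => i; rewrite -!vfieldX eq_gh. Qed.

Lemma lie_vfieldX g h i :
  lie (vfield g) (vfield h) 'X_i = vfield g (h 0 i) - vfield h (g 0 i).
Proof. by rewrite -(vfieldX h i) -(vfieldX g i); apply: der_lieE. Qed.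

Definition vfield_mod g : derivation_mod K n := vfield g.

Lemma vfield_mod_is_linear : linear vfield_mod.
Proof.
move=> a g h; apply: derivation_eqP => f.
rewrite -[RHS]/(a * (\sum_i g 0 i * mderiv i f) + \sum_i h 0 i * mderiv i f).
rewrite mulr_sumr -big_split; apply: eq_bigr => i _.
by rewrite !mxE mulrDl mulrA.
Qed.

HB.instance Definition _ :=
  GRing.isLinear.Build R M (derivation_mod K n) *:%R vfield_mod vfield_mod_is_linear.

Lemma vfieldP (a : K) g h : vfield (a%:MP *: g + h) = a *: vfield g + vfield h.
Proof.
rewrite [LHS](vfield_mod_is_linear a%:MP); apply: derivation_eqP => f.
by rewrite !derivationDE derivationZE -mul_mpolyC.
Qed.

Lemma sum_vfield_mod (c : 'I_n -> R) (B : 'M[R]_n) :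
  \sum_i c i *: vfield_mod (row i B) = vfield_mod ((\row_i c i) *m B).
Proof.
by rewrite mulmx_sum_row linear_sum; apply: eq_bigr => i _; rewrite linearZ mxE.
Qed.

Lemma sum_vfield (c : 'I_n -> K) (B : 'M[R]_n) :
  \sum_i c i *: vfield (row i B) = vfield ((\row_i (c i)%:MP) *m B).
Proof.
rewrite -[RHS]/(vfield_mod _) -sum_vfield_mod; apply: eq_bigr => i _.
by apply: derivation_eqP => f; rewrite derivationZE -mul_mpolyC.
Qed.

Lemma vfield_basis (B G : 'M[R]_n) : G *m B = 1%:M ->
  is_basis [set: derivation_mod K n] (fun i => vfield_mod (row i B)).
Proof.
move=> GB; have BG := mulmx1C GB; split.
  apply/seteqP; split=> // D _; exists (fun i => ((\row_i D 'X_i) *m G) 0 i).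
  rewrite sum_vfield_mod [LHS]vfield_der; congr vfield.
  by rewrite -[LHS]mulmx1 -GB mulmxA; congr (_ *m _); apply/rowP => i; rewrite [RHS]mxE.
move=> c; rewrite sum_vfield_mod -(linear0 vfield_mod) => /vfield_inj cB i.
have : (\row_i c i) *m B *m G = 0 by rewrite cB mul0mx.
by rewrite -mulmxA BG mulmx1 => /rowP/(_ i); rewrite !mxE.
Qed.

End DerivationsOfPolynomials.

(** * The dual vector fields *)

Section DualFields.
Variables (K : fieldType) (L : finDimLieAlgType K) (n : nat) (e : n.-tuple L).
Hypothesis eb : basis_of {:L} e.
Local Notation R := {mpoly K[n]}.
Local Notation M := 'rV[R]_n.
Variables (om : 'I_n -> M).
Hypothesis flat : forall i j, dM i (om j) - dM j (om i) = - bra e (om i) (om j).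

Lemma rspan_mulmx v : rspan [set om i | i in [set: 'I_n]] v ->
  exists c : M, v = c *m (\matrix_i om i).
Proof.
elim=> {v} [|_ [i _ <-]|a v w _ [c ->] _ [d ->]].
- by exists 0; rewrite mul0mx.
- by exists (delta_mx 0 i); rewrite -rowE rowK.
- by exists (a *: c + d); rewrite mulmxDl scalemxAl.
Qed.

Variable C : 'M[R]_n.
Hypothesis C_om : C *m (\matrix_i om i) = 1%:M.

Lemma iota_inj : injective (iota e).
Proof.
move=> x y exy; rewrite (coord_basis eb (memvf x)) (coord_basis eb (memvf y)).
apply: eq_bigr => i _; congr (_ *: _); apply: (can_inj (@mpolyCK n K)).
by have /rowP/(_ i) := exy; rewrite !mxE.
Qed.

(* The field [X] with [omega(X) = x], for the form [omega = \sum_i om i dx_i]. *)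
Definition dual x : derivation K n := vfield (iota e x *m C).

Lemma dual_inj : injective dual.
Proof.
move=> x y /vfield_inj /(congr1 (mulmx^~ (\matrix_i om i))).
by rewrite -!mulmxA C_om !mulmx1 => /iota_inj.
Qed.

Lemma dual_linear : linear dual.
Proof. by move=> a x y; rewrite /dual iotaP mulmxDl -scalemxAl vfieldP. Qed.

(* Differentiating [\sum_i h_i om_i = const] along [vfield g]. *)
Lemma vfield_const g h y : h *m (\matrix_i om i) = iota e y ->
  \sum_i vfield g (h 0 i) *: om i = - \sum_i \sum_j (h 0 i * g 0 j) *: dM j (om i).
Proof.
move=> hy; apply/eqP; rewrite -addr_eq0 -big_split /=; apply/eqP.
have : \sum_j g 0 j *: dM j (h *m (\matrix_i om i)) = 0.
  by rewrite big1 // => j _; rewrite hy dM_iota scaler0.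
rewrite mulmx_sum_row => hdM; rewrite -[RHS]hdM.
under [in RHS]eq_bigr do rewrite raddf_sum scaler_sumr.
rewrite [RHS]exchange_big; apply: eq_bigr => i _ /=.
rewrite scaler_suml -big_split; apply: eq_bigr => j _ /=.
by rewrite rowK dMZ scalerDr !scalerA [h 0 i * _]mulrC.
Qed.

(** Cartan's formula: as [omega(X)] and [omega(Y)] are constant, [d omega(X, Y)] reduces to [-
    omega([X, Y])], and the Maurer-Cartan equation makes it [- [x, y]]. *)
Lemma mc_lie g h x y :
    g *m (\matrix_i om i) = iota e x -> h *m (\matrix_i om i) = iota e y ->
  \sum_i (vfield g (h 0 i) - vfield h (g 0 i)) *: om i = iota e (lie x y).
Proof.
move=> gx hy; have eg := vfield_const g hy; have eh := vfield_const h gx.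
under eq_bigr do rewrite scalerBl.
rewrite [LHS]sumrB [X in X - _]eg [X in _ - X]eh opprK addrC exchange_big /= -sumrB.
rewrite -bra_iota // (braC eb) -gx -hy !mulmx_sum_row bra_suml -[RHS]sumrN.
apply: eq_bigr => i _; rewrite braZl bra_sumr scaler_sumr -[RHS]sumrN -sumrB.
apply: eq_bigr => j _; rewrite !rowK braZr scalerA -[RHS]scalerN -flat scalerBr.
by rewrite [g 0 j * _]mulrC.
Qed.

Lemma dual_lie x y : dual (lie x y) = lie (dual x) (dual y).
Proof.
rewrite [RHS]vfield_der; congr vfield.
(* [C] inverts the matrix of [omega], so both sides may be compared after applying [omega]. *)
rewrite -[RHS]mulmx1 -(mulmx1C C_om) mulmxA; congr (_ *m _).
rewrite -(@mc_lie (iota e x *m C) (iota e y *m C)); try by rewrite -mulmxA C_om mulmx1.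
rewrite [RHS]mulmx_sum_row; apply: eq_bigr => i _; rewrite rowK; congr (_ *: _).
by rewrite [RHS]mxE lie_vfieldX.
Qed.

End DualFields.

(** * The basic subalgebra as the range of the dual fields *)

Theorem theorem2 (K : closedFieldType) (charK : [pchar K] =i pred0)
    (n : nat) (n_ge1 : (1 <= n)%N)
    (L : finDimLieAlgType K) (dimL : \dim {:L} = n) :
  exists S : set (derivation K n),
    basic S /\ exists phi : L -> derivation K n, lie_isom_onto S phi.
Proof.
have [e eb] : exists e : n.-tuple L, basis_of {:L} e.
  by rewrite -dimL; exists (vbasis {:L}); apply: vbasisP.
have [om [flat sp]] := mc_exists charK eb.
have [C C_om] : exists C, C *m (\matrix_i om i) = 1%:M.
  (* Row [k] of [C] expresses the [k]-th unit vector through the values [om i]. *)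
  have /choice[c ec] := fun k : 'I_n => rspan_mulmx (sp (delta_mx 0 k)).
  exists (\matrix_k c k); apply/row_matrixP => k.
  by rewrite row_mul rowK -ec row1.
pose phi := dual e C.
have philin : linear phi := dual_linear e C.
have phiZ a x : phi (a *: x) = a *: phi x.
  have := philin a x 0; have := philin (-1) 0 0.
  by rewrite scaler0 addr0 scaleN1r addNr => -> /[!addr0].
exists (range phi); split; last first.
  exists phi; split; [exact: philin|exact: (dual_lie eb flat C_om)|].
  split=> [x _|x y _ _|_ [x _ <-]]; [by exists x| exact: (dual_inj eb C_om)|by exists x].
have phiE (k : 'I_n) : phi e`_k = vfield (row k C).
  congr vfield; rewrite [RHS]rowE; congr (_ *m _); apply/rowP => j.
  by rewrite !mxE coord_free ?(basis_free eb) // eq_sym mulrb; case: eqP.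
have phi_sum (c : 'I_n -> K) (y : 'I_n -> L) : phi (\sum_i c i *: y i) = \sum_i c i *: phi (y i).
  elim/big_rec2: _ => [|i u v _ <-]; last by rewrite philin.
  by rewrite -(scale0r 0) phiZ scale0r.
split.
- split.
  + by exists 0 => //; rewrite -(scale0r 0) phiZ scale0r.
  + by move=> a _ _ [x _ <-] [y _ <-]; exists (a *: x + y) => //; apply: philin.
  + by move=> _ _ [x _ <-] [y _ <-]; exists (lie x y) => //; exact: (dual_lie eb flat C_om).
- exists (fun k => phi e`_k); split.
    apply/seteqP; split=> [_ [x _ <-]|_ [c ->]].
      exists (fun k => coord e k x); rewrite -phi_sum; congr phi.
      exact: (coord_basis eb (memvf x)).
    by exists (\sum_k c k *: e`_k) => //; apply: phi_sum.
  move=> c; rewrite -phi_sum -(scale0r (phi 0)) -phiZ => /(dual_inj eb C_om).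
  by rewrite scale0r => /freeP; apply; apply: basis_free eb.
(* If [B] is the coefficient matrix of a basis of the range over [K], then [C = A *m B] with [A]
   constant, and [(\matrix_i om i) *m A] is a left inverse of [B]. *)
- move=> b [bS _].
  have /choice[y ey] : forall i : 'I_n, exists y, phi y = b i.
    move=> i; have : range phi (b i).
      rewrite bS; exists (fun j => (i == j)%:R).
      rewrite (bigD1 i) //= eqxx scale1r big1 ?addr0 // => j ji.
      by rewrite eq_sym (negPf ji) scale0r.
    by case=> x _ <-; exists x.
  pose B : 'M[{mpoly K[n]}]_n := \matrix_i (iota e (y i) *m C).
  have bE i : b i = vfield (row i B) by rewrite rowK -ey.
  have /choice[a ea] : forall k : 'I_n, exists a : 'I_n -> K, phi e`_k = \sum_i a i *: b i.
    by move=> k; have : range phi (phi e`_k) by []; rewrite bS.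
  pose A : 'M[{mpoly K[n]}]_n := \matrix_(k, i) (a k i)%:MP.
  have CAB : C = A *m B.
    apply/row_matrixP => k; apply: vfield_inj; rewrite -phiE ea.
    under eq_bigr do rewrite bE.
    rewrite sum_vfield row_mul; congr (vfield (_ *m _)).
    by apply/rowP => i; rewrite !mxE.
  have -> : b = fun i => vfield (row i B) by apply/funext.
  apply: (vfield_basis (G := (\matrix_i om i) *m A)).
  by rewrite -mulmxA -CAB mulmx1C.
Qed.
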